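(* Let $\sigma,\sigma_1,\sigma_2>0$ and let $a,b_1,b_2$ be independent real random variables with probability densities $$g_a(x)=\frac{1}{\sigma\sqrt{\pi}}e^{-x^2/\sigma^2},\qquad g_{b_i}(x)=\frac{1}{\sigma_i\sqrt{\pi}}e^{-x^2/\sigma_i^2}\quad(i=1,2).$$ Let $S=2\sqrt{a^2+b_1b_2}$ be the level spacing of the random matrix $\begin{pmatrix} a & b_1\\ b_2 & -a\end{pmatrix}$ under the constraint that $b_1$ and $b_2$ are both positive or both negative, i.e. $b_1b_2>0$, and let $P_{+}$ be the continuous version on $(0,\infty)$ of the density of the (sub-probability) measure $E\mapsto\Pr\bigl(b_1b_2>0,\ 2\sqrt{a^2+b_1b_2}\in E\bigr)$ on Borel sets $E\subseteq(0,\infty)$. Then the level repulsion is quadratic with a logarithmic correction: $P_+(S)\propto S^2\ln S^{-2}$ as $S\to0^+$, i.e. the limit $$\lim_{S\to0^+}\frac{P_{+}(S)}{S^2\,\ln (S^{-2})}$$ exists and is a finite, strictly positive number.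
   Context: The matrix $\begin{pmatrix} a & b_1\\ b_2 & -a\end{pmatrix}$ has eigenvalues $\lambda_{1,2}=\pm\sqrt{a^2+b_1b_2}$, and the level spacing is $|\lambda_1-\lambda_2|$. When $b_1b_2>0$ the eigenvalues are real and the spacing is $2\sqrt{a^2+b_1b_2}$. The conditional density of the spacing given $b_1b_2>0$ is $P_+$ divided by $\Pr(b_1b_2>0)=1/2$, so its small-$S$ behaviour is the same up to a constant factor. *)

(* Defs.v *)
From HB Require Import structures.
From mathcomp Require Import all_boot all_order all_algebra.
From mathcomp Require Import all_classical all_reals all_analysis.
From mathcomp Require Import ring.

Set Implicit Arguments.
Unset Strict Implicit.
Unset Printing Implicit Defensive.

Import Order.TTheory GRing.Theory Num.Theory.
Import numFieldNormedType.Exports.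

Local Open Scope classical_set_scope.
Local Open Scope ring_scope.

(* The scale s is not the standard deviation: the variance is s ^+ 2 / 2. *)
Definition gauss_density (R : realType) (s x : R) : R :=
  (s * Num.sqrt pi)^-1 * expR (- (x ^+ 2 / s ^+ 2)).

Definition has_density (d : measure_display) (T : measurableType d)
    (R : realType) (P : probability T R) (X : {RV P >-> R}) (g : R -> R) : Prop :=
  forall A : set R, measurable A ->
    distribution P X A = (\int[lebesgue_measure]_(x in A) (g x)%:E)%E.

(* Taking some of the sets equal to setT gives the product rule for the
   subfamilies, so this is mutual independence. *)
Definition independent3 (d : measure_display) (T : measurableType d)
    (R : realType) (P : probability T R) (X Y Z : {RV P >-> R}) : Prop :=
  forall A B C : set R, measurable A -> measurable B -> measurable C ->
    P (X @^-1` A `&` Y @^-1` B `&` Z @^-1` C) =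
    (P (X @^-1` A) * P (Y @^-1` B) * P (Z @^-1` C))%E.

Definition level_mx (R : realType) (a b1 b2 : R) : 'M[R]_2 :=
  \matrix_(i < 2, j < 2)
    if i == 0 then (if j == 0 then a else b1) else (if j == 0 then b2 else - a).

(* Num.sqrt vanishes on negative arguments, so this is the level spacing of
   level_mx only when the eigenvalues are real, in particular when
   0 < b1 * b2: see level_spacingE. *)
Definition level_spacing (R : realType) (a b1 b2 : R) : R :=
  2 * Num.sqrt (a ^+ 2 + b1 * b2).

Lemma level_spacingE (R : realType) (a b1 b2 : R) : 0 < b1 * b2 ->
  exists l1 l2 : R,
    char_poly (level_mx a b1 b2) = ('X - l1%:P) * ('X - l2%:P) /\
    level_spacing a b1 b2 = `|l1 - l2|.
Proof.
move=> b_gt0; set r := Num.sqrt (a ^+ 2 + b1 * b2).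
have r2 : r ^+ 2 = a ^+ 2 + b1 * b2.
  by rewrite sqr_sqrtr // addr_ge0 ?sqr_ge0 // ltW.
exists r, (- r); split; last first.
  by rewrite opprK -mulr2n -mulr_natl ger0_norm // mulr_ge0 // sqrtr_ge0.
rewrite /char_poly (expand_det_row _ ord0) !big_ord_recl big_ord0 /cofactor
  !det_mx11 !mxE /= !mulr1n !mulr0n.
have rP : r%:P ^+ 2 = a%:P ^+ 2 + b1%:P * b2%:P :> {poly R}.
  by rewrite !expr2 -!polyCM -polyCD -!expr2 r2.
transitivity ('X ^+ 2 - r%:P ^+ 2 : {poly R}).
  by rewrite rP !polyCN /bump /= !add0n expr0 expr1; ring.
by rewrite polyCN; ring.
Qed.

(* The measure E |-> Pr (b1 b2 > 0, S in E); only its values on Borel subsets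
   of `]0, +oo[ are used. *)
Definition spacing_measure (d : measure_display) (T : measurableType d)
    (R : realType) (P : probability T R) (a b1 b2 : {RV P >-> R})
    (E : set R) : \bar R :=
  P [set w | 0 < b1 w * b2 w /\ E (level_spacing (a w) (b1 w) (b2 w))].

(* The values of p outside `]0, +oo[ are irrelevant; on `]0, +oo[ continuity
   determines p uniquely. *)
Definition is_continuous_spacing_density (d : measure_display)
    (T : measurableType d) (R : realType) (P : probability T R)
    (a b1 b2 : {RV P >-> R}) (p : R -> R) : Prop :=
  [/\ forall s : R, 0 < s -> {for s, continuous p},
      forall s : R, 0 < s -> 0 <= p s &
      forall E : set R, measurable E -> E `<=` `]0, +oo[ ->
        spacing_measure a b1 b2 E =
        (\int[lebesgue_measure]_(s in E) (p s)%:E)%E].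

(* Main.v *)
Require Import Defs.
From HB Require Import structures.
From mathcomp Require Import all_boot all_order all_algebra.
From mathcomp Require Import all_classical all_reals all_analysis.
From mathcomp Require Import measurable_realfun.
From mathcomp Require Import ring lra.
Set Implicit Arguments.
Unset Strict Implicit.
Unset Printing Implicit Defensive.
Import Order.TTheory GRing.Theory Num.Theory.
Import numFieldNormedType.Exports.
Local Open Scope classical_set_scope.
Local Open Scope ring_scope.

(** The event [b1 * b2 > 0] splits into two symmetric halves. Conditioning on [a]
    and [b1] and substituting [b2 = (r ^+ 2 / 4 - a ^+ 2) / b1], with [a = r t / 2]
    and [`|b1| = expR u], gives the density of the spacing
      p r = r ^+ 2 / 2 * \int_(|t| < 1) \int_u
              ga (r t / 2) g1 (expR u) g2 (r ^+ 2 / 4 (1 - t ^+ 2) expR (- u)),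
    whose inner integral is the Bessel function K_0 up to constants.

    No estimate of that integral is needed. As the total mass is at most 1, it is
    finite for arbitrarily small [r]; without the bounded factor [ga] the integrand
    is nonincreasing in [r], so it is integrable for every [r > 0] and dominates the
    integrands of all larger [r], whence the continuity of [p].

    For the asymptotics put [c = ln (r ^- 2)] and [u = c v]: then
      p r / (r ^+ 2 c) = 1/2 \int_(|t| < 1) \int_v ga (r t / 2) g1 (expR (c v))
                               g2 ((1 - t ^+ 2) / 4 expR (- c (1 + v))).
    For [1 <= c] this integrand is at most a constant times its value at [c = 1],
    and as [c] tends to infinity it tends to [ga 0 * g1 0 * g2 0] if [-1 < v < 0]
    and to [0] if [v < -1] or [0 < v]. Hence the limit is [ga 0 * g1 0 * g2 0]. *)

(** * Measures and changes of variable *)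

(* The measure structure of [pushforward] depends on a measurability proof that
   canonical structures cannot find by themselves. *)
Definition pushforward_measure d d' (T : measurableType d) (T' : measurableType d')
    (R : realType) (m : {measure set T -> \bar R}) (f : T -> T')
    (mf : measurable_fun setT f) : {measure set T' -> \bar R} :=
  measure_function_pushforward__canonical__measure_function_Measure m mf.

Section integral_density.
Context d (T : measurableType d) (R : realType).
Variables (mu nu : {measure set T -> \bar R}) (g : T -> R).
Hypotheses (mg : measurable_fun setT g) (g0 : forall x, 0 <= g x).
Hypothesis nuE : forall A, measurable A -> nu A = (\int[mu]_(x in A) (g x)%:E)%E.

Import HBNNSimple.
Local Open Scope ereal_scope.

(** Both sides pass to the limit along simple functions increasing to [f], by monotone convergence.
    Linearity then reduces the claim to indicators, where it is the hypothesis [nuE]. *)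
Lemma ge0_integral_density (f : T -> \bar R) :
  measurable_fun setT f -> (forall x, 0 <= f x) ->
  \int[nu]_x f x = \int[mu]_x (f x * (g x)%:E).
Proof.
move=> mf f0; pose h := nnsfun_approx measurableT mf.
have mge : measurable_fun setT (EFin \o g) by exact/measurable_EFinP.
have -> : \int[nu]_x f x = lim (\int[nu]_x (EFin \o h n) x @[n --> \oo]).
  have fE x : f x = lim ((EFin \o h n) x @[n --> \oo]).
    by apply/esym/cvg_lim => //; exact: cvg_nnsfun_approx.
  under eq_integral do rewrite fE.
  apply: monotone_convergence => //.
  - by move=> n; apply/measurable_EFinP; exact/measurable_funP.
  - by move=> n x _ /=; rewrite lee_fin.
  - by move=> x _ a b ab; rewrite lee_fin; exact/lefP/nd_nnsfun_approx.
have -> : \int[mu]_x (f x * (g x)%:E) =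
    lim (\int[mu]_x ((EFin \o h n) x * (g x)%:E) @[n --> \oo]).
  have fE x : f x * (g x)%:E = lim ((EFin \o h n) x * (g x)%:E @[n --> \oo]).
    by apply/esym/cvg_lim => //; apply: cvgeZr;
      [by []|exact: cvg_nnsfun_approx].
  under eq_integral do rewrite fE.
  apply: monotone_convergence => //.
  - move=> n; apply: emeasurable_funM => //.
    by apply/measurable_EFinP; exact/measurable_funP.
  - by move=> n x _ /=; rewrite mule_ge0 ?lee_fin.
  - move=> x _ a b ab /=; rewrite lee_wpmul2r ?lee_fin//.
    exact/lefP/nd_nnsfun_approx.
suff E n : \int[nu]_x (EFin \o h n) x = \int[mu]_x ((EFin \o h n) x * (g x)%:E).
  by under eq_fun do rewrite E.
transitivity (\int[nu]_x
   (\sum_(y \in range (h n)) (y * \1_(h n @^-1` [set y]) x)%:E)).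
  by apply: eq_integral => t _; rewrite /= fimfunE -fsumEFin.
rewrite ge0_integral_fsum//; last 2 first.
- by move=> y; exact/measurable_EFinP/measurable_funM.
- by move=> y x _; exact: nnfun_muleindic_ge0.
transitivity (\int[mu]_x (\sum_(y \in range (h n))
    (y * \1_(h n @^-1` [set y]) x)%:E * (g x)%:E)); last first.
  apply: eq_integral => x _.
  rewrite -ge0_mule_fsuml => [|y]; last exact: nnfun_muleindic_ge0.
  by rewrite fsumEFin // -(fimfunE _ x).
rewrite ge0_integral_fsum//; last 2 first.
- move=> y; apply: emeasurable_funM => //.
  exact/measurable_EFinP/measurable_funM.
- move=> y x _; apply: mule_ge0; last by rewrite lee_fin.
  exact: nnfun_muleindic_ge0.
apply: eq_fsbigr => r; rewrite inE/= => -[x _ <-].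
set A := h n @^-1` _; have mA : measurable A.
  by rewrite -[A]setTI; apply: (measurable_funP (h n)).
under eq_integral do rewrite EFinM.
under [RHS]eq_integral do rewrite EFinM -muleA.
have h0 : 0 <= (h n x)%:E by rewrite lee_fin.
rewrite ge0_integralZl//; last by apply/measurable_EFinP.
rewrite ge0_integralZl//; last 2 first.
- by apply: emeasurable_funM => //; apply/measurable_EFinP.
- by move=> y _; rewrite mule_ge0 ?lee_fin.
congr (_ * _); rewrite integral_indic// setIT nuE// [LHS]integral_mkcond.
apply: eq_integral => y _; rewrite patchE indicE.
by case: ifPn => yA; rewrite ?mul1e ?mul0e.
Qed.

End integral_density.

(** The intervals []a, b]] are stable under intersection and generate the Borel sets, and the []- n,
    n]], of finite measure, exhaust the line. *)
Lemma measure_unique_itvoc (R : realType)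
    (m1 m2 : {measure set (measurableTypeR R) -> \bar R}) :
  (forall a b : R, a < b -> m1 `]a, b]%classic = m2 `]a, b]%classic) ->
  (forall a b : R, (m1 `]a, b]%classic < +oo)%E) ->
  forall A, measurable A -> m1 A = m2 A.
Proof.
move=> m12 m1oo A mA.
apply: (@measure_unique _ R (measurableTypeR R) (@ocitv R)
  (fun n => `]- n%:R, n%:R]%classic)) => //.
- exact: ocitvI.
- by move=> i; exact: is_ocitv.
- exact: bigcup_itvT.
- move=> _ [[a b] _ <-] /=; have [ab|ba] := ltP a b; first exact: m12.
  by rewrite set_itv_ge ?measure0// bnd_simp -leNgt.
Qed.

(** Finiteness allows the measure of []a, b]] to be written as a difference of the measures of two
    rays, so the distribution function determines the measure. *)
Lemma finite_measure_unique_itvNyc (R : realType)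
    (m1 m2 : {measure set (measurableTypeR R) -> \bar R}) :
  (m1 setT < +oo)%E ->
  (forall s : R, m1 `]-oo, s]%classic = m2 `]-oo, s]%classic) ->
  forall A, measurable A -> m1 A = m2 A.
Proof.
move=> m1T m12.
have fin1 (A : set (measurableTypeR R)) : measurable A -> (m1 A < +oo)%E.
  by move=> mA; apply: le_lt_trans m1T; rewrite le_measure ?inE//; exact: measurableT.
apply: measure_unique_itvoc => [a b ab|a b]; last exact: fin1.
have E : `]a, b]%classic = `]-oo, b] `\` `]-oo, a].
  by rewrite -[RHS]setCK setCD setCitvl setUC -[LHS]setCK setCitv.
have I : `]-oo, b] `&` `]-oo, a] = `]-oo, a]%classic.
  by apply/setIidr; apply: subset_itvl; rewrite bnd_simp ltW.
have D (m : {measure set (measurableTypeR R) -> \bar R}) :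
    (m `]-oo, b]%classic < +oo)%E ->
    m `]a, b]%classic = (m `]-oo, b]%classic - m `]-oo, a]%classic)%E.
  by move=> moo; rewrite E measureD// I.
by rewrite !D -?m12// fin1.
Qed.

Section density_measure.
Context d (T : measurableType d) (R : realType).
Variables (mu : {measure set T -> \bar R}) (g : T -> R).
Hypotheses (mg : measurable_fun setT g) (g0 : forall x, 0 <= g x).

(** The proofs that [g] is measurable and nonnegative are arguments, so that the measure structure
    can be attached to the term itself. *)
Definition density_measure of measurable_fun setT g & (forall x, 0 <= g x) :
  set T -> \bar R := fun A => (\int[mu]_(x in A) (g x)%:E)%E.

Local Notation nu := (density_measure mg g0).

Let nu0 : nu set0 = 0%E.
Proof. by rewrite /density_measure integral_set0. Qed.

Let nu_ge0 A : (0 <= nu A)%E.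
Proof. by apply: integral_ge0 => x _; rewrite lee_fin. Qed.

Let nu_sigma_additive : semi_sigma_additive nu.
Proof.
move=> F mF tF mUF; rewrite /density_measure ge0_integral_bigcup//; last 2 first.
- by apply/measurable_EFinP; exact: measurable_funTS.
- by move=> x _; rewrite lee_fin.
by apply: is_cvg_ereal_nneg_natsum_cond => n _ _; exact: nu_ge0.
Qed.

HB.instance Definition _ := isMeasure.Build _ _ _ nu
  nu0 nu_ge0 nu_sigma_additive.

End density_measure.

Section change_of_variable.
Context (R : realType).
Notation mu := (@lebesgue_measure R).
Variables (D : set R) (F G : R -> R).
Hypotheses (mD : measurable D) (mG : measurable_fun setT G).
Hypothesis FD : forall u, D (F u).
Hypothesis FG : forall x, D x -> F (G x) = x.
Hypothesis oD : forall x y z : R, D x -> D z -> x <= y <= z -> D y.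
Hypothesis Fincr : {mono F : u v / u < v}.
Variable F' : R -> R.
Hypothesis dF : forall u : R, is_derive u 1 F (F' u).
Hypothesis cF' : continuous F'.

Let derF (u : R) : derivable F u 1.
Proof. by case: (dF u). Qed.

Let F'E : (F^`() = F')%classic.
Proof. by apply/funext => u; rewrite derive1E; apply: derive_val. Qed.

Let F'_ge0 u : 0 <= F' u.
Proof.
rewrite -F'E.
apply: (@incr_derive1_ge0 _ _ setT) => //; first by move=> x y _ _; rewrite Fincr.
by rewrite interiorT.
Qed.

Let mF' : measurable_fun setT F'.
Proof. exact: continuous_measurable_fun. Qed.

Let cF : continuous F.
Proof. by move=> x; exact/differentiable_continuous/derivable1_diffP. Qed.

Lemma integral_derive_itvoc (a b : R) : a < b ->
  (\int[mu]_(u in `]a, b]) (F' u)%:E = (F b - F a)%:E)%E.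
Proof.
move=> ab; rewrite integral_itv_obnd_cbnd; last first.
  by apply/measurable_EFinP; exact: measurable_funTS.
rewrite (@continuous_FTC2 _ _ F)//.
- by apply: continuous_subspaceT; exact: cF'.
- split=> //; first exact/cvg_at_right_filter/cF.
  exact/cvg_at_left_filter/cF.
- by move=> x _; rewrite F'E.
Qed.

(** [F] maps []a, b]] onto []F a, F b]], whose length is the integral of [F']. Hence the image under
    [G] of Lebesgue measure on [D] has density [F']. *)
Lemma lebesgue_measure_incr (A : set (measurableTypeR R)) : measurable A ->
  mu (D `&` G @^-1` A) = (\int[mu]_(u in A) (F' u)%:E)%E.
Proof.
move=> mA.
pose m1 := density_measure mu mF' F'_ge0.
pose m2 : {measure set (measurableTypeR R) -> \bar R} :=
  pushforward_measure
    (mrestr mu mD) (mG : measurable_fun setT (G : measurableTypeR R -> measurableTypeR R)).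
transitivity (m2 A); first by rewrite /= /pushforward /mrestr setIC.
apply/esym; apply: (@measure_unique_itvoc _ m1 m2) => // [a b ab|a b].
  rewrite /= /density_measure integral_derive_itvoc// /pushforward /mrestr.
  rewrite (_ : _ `&` _ = `]F a, F b]%classic).
    by rewrite lebesgue_measure_itv/= lte_fin Fincr ab EFinB.
  apply/seteqP; split=> x /=; rewrite !in_itv/=.
    move=> [/andP[ax xb] /FG <-]; rewrite Fincr ax/=.
    by rewrite leNgt Fincr -leNgt.
  move=> /andP[ax xb].
  have Dx : D x by apply: (oD (FD a) (FD b)); rewrite (ltW ax).
  split=> //; rewrite -Fincr FG// ax/=.
  by rewrite leNgt -Fincr FG// -leNgt.
have [ab|ba] := ltP a b; last by rewrite set_itv_ge ?measure0// bnd_simp -leNgt.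
by rewrite /= /density_measure integral_derive_itvoc// ltry.
Qed.

(** The function [f \o F] is integrated against the image measure in two ways: its density gives the
    right-hand side, and pulling back along [G], with [F (G x) = x] on [D], gives the left-hand
    side. *)
Lemma ge0_change_of_variable (f : R -> \bar R) :
  measurable_fun setT f -> (forall x, 0 <= f x)%E ->
  (\int[mu]_(x in D) f x = \int[mu]_u (f (F u) * (F' u)%:E))%E.
Proof.
move=> mf f0.
have mfF : measurable_fun setT (f \o F).
  by apply: measurableT_comp => //; exact: continuous_measurable_fun.
pose m2 : {measure set (measurableTypeR R) -> \bar R} :=
  pushforward_measure
    (mrestr mu mD) (mG : measurable_fun setT (G : measurableTypeR R -> measurableTypeR R)).
rewrite -(@ge0_integral_density _ _ _ mu m2 _ mF' F'_ge0)//=; last first.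
  by move=> A mA; rewrite /= /pushforward /mrestr setIC lebesgue_measure_incr.
rewrite ge0_integral_pushforward//= preimage_setT.
pose m0 : {measure set (measurableTypeR R) -> \bar R} := mrestr mu mD.
have mfFG : measurable_fun setT (f \o F \o G) by exact: measurableT_comp.
have m0E A : measurable A -> m0 A = (\int[mu]_(x in A) (\1_D x)%:E)%E.
  by move=> mA; rewrite integral_indic// setIC.
rewrite (ge0_integral_density _ _ m0E)//=.
rewrite integral_mkcond; apply: eq_integral => x _ /=.
rewrite patchE indicE; case: ifPn => [/set_mem xD|_]; last by rewrite mule0.
by rewrite mule1 FG.
Qed.
End change_of_variable.

Section substitutions.
Context (R : realType).
Notation mu := (@lebesgue_measure R).
Implicit Type f : R -> \bar R.
Local Open Scope ereal_scope.

Lemma ge0_integral_substitution_exp f :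
  measurable_fun setT f -> (forall x, 0 <= f x) ->
  \int[mu]_(x in `]0%R, +oo[) f x = \int[mu]_u (f (expR u) * (expR u)%:E).
Proof.
move=> mf f0; apply: (@ge0_change_of_variable R _ _ (@ln R)) => //.
- by move=> u; rewrite /= in_itv/= expR_gt0.
- by move=> x; rewrite /= in_itv/= andbT => x0; rewrite lnK.
- move=> x y z; rewrite /= !in_itv/= !andbT => x0 _ /andP[xy _].
  exact: lt_le_trans xy.
- by move=> u v; rewrite ltr_expR.
- exact: continuous_expR.
Qed.

Lemma ge0_integral_substitution_scale f (k : R) : (0 < k)%R ->
  measurable_fun setT f -> (forall x, 0 <= f x) ->
  \int[mu]_x f x = \int[mu]_u (f (k * u)%R * k%:E).
Proof.
move=> k0 mf f0.
apply: (@ge0_change_of_variable R setT ( *%R k) ( *%R k^-1) _ _ _ _ _ _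
  (cst k)) => //.
- by move=> u _ /=; rewrite mulVKf// gt_eqF.
- by move=> u v; rewrite ltr_pM2l.
- move=> u; have := @is_deriveZ R R R id k u 1%R 1%R _.
  by rewrite /GRing.scale/= mulr1; apply.
- by move=> u; exact: cst_continuous.
Qed.

Lemma ge0_integral_even f :
  measurable_fun setT f -> (forall x, 0 <= f x) -> (forall x, f (- x)%R = f x) ->
  \int[mu]_x f x = 2%:E * \int[mu]_(x in `]0%R, +oo[) f x.
Proof.
move=> mf f0 fN; rewrite -[in LHS](setUv `]-oo, 0%R]%classic) setCitvl.
rewrite ge0_integral_setU//=; last 2 first.
- exact: measurable_funTS.
- by rewrite -setCitvl; apply/disj_setPCl.
rewrite mule_natl mule2n; congr (_ + _).
rewrite integral_itv_obnd_cbnd; last exact: measurable_funTS.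
rewrite ge0_integration_by_substitution0//.
by apply: eq_integral => x _; rewrite fN.
Qed.

End substitutions.

(** * Joint law of three independent variables *)

Section joint_law.
Context d (T : measurableType d) (R : realType) (P : probability T R).
Variables (X Y Z : {RV P >-> R}).
Hypothesis indep : independent3 X Y Z.
Local Open Scope ereal_scope.

Let mXY : measurable_fun setT (fun w => (X w, Y w)).
Proof. exact: measurable_fun_pair. Qed.

Let mXYZ : measurable_fun setT (fun w => ((X w, Y w), Z w)).
Proof. exact: measurable_fun_pair. Qed.

(** For fixed [C] both sides are measures in [A] that agree on rectangles by independence; the mass
    of [C] is absorbed as a scale factor of the law of [Y]. *)
Let joint_law2 (A : set (R * R)) (C : set R) : measurable A -> measurable C ->
  P ((fun w => (X w, Y w)) @^-1` A `&` Z @^-1` C) =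
  (distribution P X \x distribution P Y) A * distribution P Z C.
Proof.
move=> mA mC.
have mZC : measurable (Z @^-1` C) by rewrite -[X in measurable X]setTI; exact: measurable_funP.
pose r : {nonneg R} := NngNum (fine_ge0 (measure_ge0 P (Z @^-1` C))).
have rE : r%:num%:E = distribution P Z C by rewrite /= fineK ?fin_num_measure.
pose m : {measure set (R * R) -> \bar R} :=
  pushforward_measure
    (mrestr P mZC) mXY.
transitivity (m A); first by [].
rewrite -(@product_measure_unique _ _ _ _ _ (distribution P X) (mscale r (distribution P Y)))//.
  rewrite /product_measure1 /= /mscale.
  rewrite -rE muleC -ge0_integralZl//; exact: measurable_fun_xsection.
move=> B B' mB mB'; rewrite /= /mscale /= rE /pushforward /mrestr.
rewrite (_ : _ @^-1` _ = X @^-1` B `&` Y @^-1` B')// indep//.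
by rewrite -muleA [in RHS](muleC _ (P _)).
Qed.

Lemma independent3_joint_law (Q : set (R * R * R)) : measurable Q ->
  P ((fun w => ((X w, Y w), Z w)) @^-1` Q) =
  ((distribution P X \x distribution P Y) \x distribution P Z) Q.
Proof.
move=> mQ.
pose m : {measure set (R * R * R) -> \bar R} :=
  pushforward_measure P mXYZ.
transitivity (m Q); first by [].
pose DXY : subprobability (R * R)%type R := product_subprobability
  (distribution P X : subprobability _ R, distribution P Y : subprobability _ R).
apply/esym/(@product_measure_unique _ _ _ _ _ DXY (distribution P Z) m) => //.
Qed.

End joint_law.

(** * Gaussian densities *)

Section gauss_density_lemmas.
Context (R : realType) (s : R).
Hypothesis s0 : 0 < s.

Lemma gauss_density_gt0 x : 0 < gauss_density s x.
Proof. by rewrite /gauss_density mulr_gt0 ?expR_gt0// invr_gt0 mulr_gt0// sqrtr_gt0 pi_gt0. Qed.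

Lemma gauss_density_ge0 x : 0 <= gauss_density s x.
Proof. exact/ltW/gauss_density_gt0. Qed.

(** The domination bounds below rest on this monotonicity. *)
Lemma gauss_density_le x y : `|x| <= `|y| -> gauss_density s y <= gauss_density s x.
Proof.
move=> xy; rewrite /gauss_density ler_pM2l; last first.
  by rewrite invr_gt0 mulr_gt0// sqrtr_gt0 pi_gt0.
rewrite ler_expR lerN2 ler_pM2r ?invr_gt0 ?exprn_gt0//.
by rewrite -(real_normK (num_real x)) -(real_normK (num_real y)) lerXn2r ?nnegrE.
Qed.

Lemma gauss_densityN x : gauss_density s (- x) = gauss_density s x.
Proof. by rewrite /gauss_density sqrrN. Qed.

Lemma continuous_gauss_density : continuous (gauss_density s).
Proof.
move=> x; rewrite /gauss_density; apply: cvgM; first exact: cvg_cst.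
apply: continuous_comp; last exact: continuous_expR.
apply: cvgN; apply: cvgM; last exact: cvg_cst.
exact: exprn_continuous.
Qed.

Lemma measurable_gauss_density : measurable_fun setT (gauss_density s).
Proof. exact: continuous_measurable_fun continuous_gauss_density. Qed.

Lemma measurable_gauss_density_comp d (T : measurableType d) (f : T -> R) :
  measurable_fun setT f -> measurable_fun setT (gauss_density s \o f).
Proof. by move=> mf; apply: measurableT_comp => //; exact: measurable_gauss_density. Qed.

End gauss_density_lemmas.

(** The substitution [y = (q ^+ 2 / 4 - a ^+ 2) * c], where [c] stands for the inverse of a positive
    [b1], trades the integral over [b2] for one over the spacing [q]. The conditional encodes
    [y > 0]. *)
Lemma integral_gauss_density_section (R : realType) (s a c r : R) :
  0 < s -> 0 < c -> 0 < r ->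
  (\int[lebesgue_measure]_(y in `]0%R, ((r ^+ 2 / 4 - a ^+ 2) * c)%R]) (gauss_density s y)%:E =
   \int[lebesgue_measure]_(q in `]0%R, r])
     (if 2 * `|a| < q then gauss_density s ((q ^+ 2 / 4 - a ^+ 2) * c) * (q / 2 * c)
      else 0)%:E)%E.
Proof.
move=> s0 c0 r0.
pose F (q : R) : R := (q ^+ 2 / 4 - a ^+ 2) * c.
(* When [r] is at most twice the absolute value of [a], the left interval is empty and the right
   integrand is zero. *)
have [ra|ar] := leP r (2 * `|a|).
  have Fr : F r <= 0.
    rewrite /F pmulr_lle0// subr_le0 -(real_normK (num_real a)).
    rewrite ler_pdivrMr// (_ : _ * 4 = (2 * `|a|) ^+ 2); last by ring.
    by rewrite lerXn2r ?nnegrE// ?(ltW r0)// mulr_ge0.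
  rewrite set_itv_ge ?integral_set0; last by rewrite bnd_simp -leNgt.
  apply/esym/integral0_eq => q; rewrite /= in_itv/= => /andP[_ qr].
  by rewrite ltNge (le_trans qr ra).
have F0 : F (2 * `|a|) = 0.
  by rewrite /F -(real_normK (num_real a)) (_ : _ - _ = 0) ?mul0r//; field.
have dF (x : R) : is_derive x 1 F (x / 2 * c).
  rewrite /F; apply: is_derive_eq.
  by rewrite /GRing.scale/= ?mulr0 ?addr0 ?add0r; field.
have F'E : (F^`() = (fun x => x / 2 * c))%classic.
  by apply/funext => u; rewrite derive1E; case: (dF u).
have cF' : continuous (fun x : R => x / 2 * c).
  move=> x; apply: cvgM; last exact: cvg_cst.
  by apply: cvgM; [exact: cvg_id|exact: cvg_cst].
have cF : continuous F.
  by move=> x; apply/differentiable_continuous/derivable1_diffP; case: (dF x).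
have cg := continuous_gauss_density (s := s).
have a0 : 0 <= 2 * `|a| by rewrite mulr_ge0.
transitivity (\int[lebesgue_measure]_(q in `](2 * `|a|)%R, r])
  (gauss_density s (F q) * (q / 2 * c))%:E)%E; last first.
  rewrite [LHS]integral_mkcond [RHS]integral_mkcond; apply: eq_integral => q _.
  rewrite !patchE; case: ifPn => [|/negP qar].
    rewrite inE/= in_itv/= => /andP[aq qr].
    by rewrite mem_set ?aq//= in_itv/= qr (le_lt_trans a0 aq).
  case: ifPn => //; rewrite inE/= in_itv/= => /andP[_ qr].
  by case: ifPn => // aq; case: qar; rewrite inE/= in_itv/= aq.
rewrite !integral_itv_obnd_cbnd; last 2 first.
- apply/measurable_EFinP; apply: measurable_funTS; apply: measurable_funM.
    by apply: measurable_gauss_density_comp; exact: continuous_measurable_fun.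
  exact: continuous_measurable_fun.
- by apply/measurable_EFinP; apply: measurable_funTS; exact: measurable_gauss_density.
rewrite -F0 -[in X in Interval _ (BRight X)]/(F r).
rewrite (@integration_by_substitution_increasing R F)//.
- by rewrite F'E.
- exact: ltW.
- move=> x y; rewrite !in_itv/= => /andP[ax _] /andP[ay _] xy.
  rewrite /F ltr_pM2r// ltrD2r ltr_pM2r ?invr_gt0//.
  by rewrite ltrXn2r ?nnegrE// (le_trans a0).
- by move=> x _; rewrite F'E; exact: cF'.
- by rewrite F'E; apply/cvg_ex; eexists; exact/cvg_at_right_filter/cF'.
- by rewrite F'E; apply/cvg_ex; eexists; exact/cvg_at_left_filter/cF'.
- split=> //; first exact/cvg_at_right_filter/cF.
  exact/cvg_at_left_filter/cF.
- exact: continuous_subspaceT.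
Qed.

(* [distribution P X] and [lebesgue_measure] live on two sigma-algebras on [R] that
   are equal but carry different displays, hence the detour through [nu]. *)
Lemma ge0_integral_has_density d (T : measurableType d) (R : realType)
    (P : probability T R) (X : {RV P >-> R}) (g : R -> R) (f : R -> \bar R) :
  has_density X g -> measurable_fun setT g -> (forall x, 0 <= g x) ->
  measurable_fun setT f -> (forall x, (0 <= f x)%E) ->
  (\int[distribution P X]_x f x = \int[lebesgue_measure]_x (f x * (g x)%:E))%E.
Proof.
move=> dX mg g0 mf f0.
have mX : measurable_fun setT (X : T -> measurableTypeR R) by exact: (measurable_funP X).
pose nu : {measure set (measurableTypeR R) -> \bar R} :=
  pushforward_measure P mX.
transitivity (\int[nu]_x f x)%E.
  by rewrite ge0_integral_distribution// ge0_integral_pushforward.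
exact: (@ge0_integral_density _ (measurableTypeR R) R lebesgue_measure nu g mg g0 dX f mf f0).
Qed.

(** * The law of the spacing *)

Section spacing_law.
Context d (T : measurableType d) (R : realType) (P : probability T R).
Variables (a b1 b2 : {RV P >-> R}) (sigma sigma1 sigma2 : R).
Hypotheses (sigma_gt0 : 0 < sigma) (sigma1_gt0 : 0 < sigma1).
Hypothesis sigma2_gt0 : 0 < sigma2.
Hypothesis indep : independent3 a b1 b2.
Hypothesis density_a : has_density a (gauss_density sigma).
Hypothesis density_b1 : has_density b1 (gauss_density sigma1).
Hypothesis density_b2 : has_density b2 (gauss_density sigma2).

Local Notation mu := (@lebesgue_measure R).
Local Notation ga := (gauss_density sigma).
Local Notation g1 := (gauss_density sigma1).
Local Notation g2 := (gauss_density sigma2).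

(** Here [x] is the value of [a] and [expR u] the absolute value of [b1]. The last factor [r] is the
    product of the Jacobian [r / 2 * expR (- u)] of the substitution for [b2], the Jacobian [expR u]
    of the exponential, and 2 for the two sign halves. *)
Definition spacing_kernel (r x u : R) : R :=
  if 2 * `|x| < r then
    ga x * (g1 (expR u) * (g2 ((r ^+ 2 / 4 - x ^+ 2) * expR (- u)) * r))
  else 0.

Lemma spacing_kernel_ge0 r x u : 0 <= spacing_kernel r x u.
Proof.
rewrite /spacing_kernel; case: ifPn => // xr.
rewrite mulr_ge0 ?gauss_density_ge0// mulr_ge0 ?gauss_density_ge0//.
by rewrite mulr_ge0 ?gauss_density_ge0// (le_trans _ (ltW xr))// mulr_ge0.
Qed.

Lemma measurable_spacing_kernel :
  measurable_fun setT (fun z : R * R * R => spacing_kernel z.1.2 z.1.1 z.2).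
Proof.
have mx : measurable_fun setT (fun z : R * R * R => z.1.1).
  exact: measurableT_comp measurable_fst.
have mr : measurable_fun setT (fun z : R * R * R => z.1.2).
  exact: measurableT_comp measurable_fst.
have mu' : measurable_fun setT (fun z : R * R * R => z.2) by exact: measurable_snd.
apply: measurable_fun_ifT => //.
  by apply: measurable_fun_ltr => //; apply: measurable_funM => //; exact: measurableT_comp.
apply: measurable_funM; first exact: measurable_gauss_density_comp.
apply: measurable_funM; first by apply: measurable_gauss_density_comp; exact: measurableT_comp.
apply: measurable_funM => //; apply: measurable_gauss_density_comp.
apply: measurable_funM; last by apply: measurableT_comp => //; exact: measurableT_comp.
by apply: measurable_funB; [apply: measurable_funM => //|]; exact: measurable_funX.
Qed.

Let distribution_b2N (A : set R) : measurable A ->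
  distribution P b2 (-%R @^-1` A) = distribution P b2 A.
Proof.
move=> mA; have mN : measurable_fun setT (-%R : R -> R) by exact: oppr_measurable.
rewrite !density_b2//; last by rewrite -[X in measurable X]setTI; exact: mN.
transitivity (\int[pushforward mu (-%R : R -> measurableTypeR R)]_(x in A) (g2 x)%:E)%E.
  rewrite ge0_integral_pushforward//.
  - by apply: eq_integral => x _; rewrite /= gauss_densityN.
  - by apply/measurable_EFinP; apply: measurable_funTS; exact: measurable_gauss_density.
  - by move=> x _; rewrite lee_fin gauss_density_ge0.
apply: eq_measure_integral => B mB _; exact: lebesgue_measureN.
Qed.

Let Q (s : R) : set (R * R * R) :=
  [set z | 0 < z.1.2 * z.2 /\ z.1.1 ^+ 2 + z.1.2 * z.2 <= s ^+ 2 / 4].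

Let measurable_Q s : measurable (Q s).
Proof.
have mx : measurable_fun setT (fun z : R * R * R => z.1.1).
  exact: measurableT_comp measurable_fst.
have my : measurable_fun setT (fun z : R * R * R => z.1.2).
  exact: measurableT_comp measurable_fst.
have mz : measurable_fun setT (fun z : R * R * R => z.2) by exact: measurable_snd.
have myz : measurable_fun setT (fun z : R * R * R => z.1.2 * z.2) by exact: measurable_funM.
rewrite (_ : Q s = ([set: R * R * R] `&` [set z | 0 < z.1.2 * z.2]) `&`
  ([set: R * R * R] `&` [set z | z.1.1 ^+ 2 + z.1.2 * z.2 <= s ^+ 2 / 4])); last first.
  by rewrite !setTI.
apply: measurableI.
  rewrite (_ : [set z | _] = (fun z : R * R * R => z.1.2 * z.2) @^-1` `]0, +oo[).
    exact: myz.
  by apply/seteqP; split=> z /=; rewrite in_itv/= andbT.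
by apply: measurable_fun_le => //; apply: measurable_funD => //; exact: measurable_funX.
Qed.

Let spacing_measureE s : 0 < s -> spacing_measure a b1 b2 `]-oo, s] =
  P ((fun w => ((a w, b1 w), b2 w)) @^-1` Q s).
Proof.
move=> s0; rewrite /spacing_measure; congr (P _); apply/seteqP.
have H w : 0 < b1 w * b2 w -> (2 * Num.sqrt (a w ^+ 2 + b1 w * b2 w) <= s) =
    (a w ^+ 2 + b1 w * b2 w <= s ^+ 2 / 4).
  move=> b0; have A0 : 0 <= a w ^+ 2 + b1 w * b2 w by rewrite addr_ge0 ?sqr_ge0 ?ltW.
  rewrite -ler_pdivlMl// -[in RHS](sqr_sqrtr A0).
  rewrite (_ : s ^+ 2 / 4 = (2^-1 * s) ^+ 2); last by field.
  by rewrite ler_pXn2r ?nnegrE// ?sqrtr_ge0 ?mulr_ge0 ?(ltW s0).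
by split=> w /= [b0]; rewrite in_itv/= /level_spacing H.
Qed.

Let xsection_Q s x u : xsection (Q s) (x, expR u) =
  `]0, (s ^+ 2 / 4 - x ^+ 2) * expR (- u)]%classic.
Proof.
apply/seteqP; split=> y; rewrite /xsection /= in_itv/=.
  move=> /set_mem[/= y0 xy]; rewrite expRN ler_pdivlMr ?expR_gt0//.
  by rewrite -(pmulr_rgt0 _ (expR_gt0 u)) y0/= lerBrDl (mulrC y).
move=> /andP[y0]; rewrite expRN ler_pdivlMr ?expR_gt0// lerBrDl (mulrC y) => xy.
by apply/mem_set; split=> //=; rewrite ?mulr_gt0 ?expR_gt0// addrC.
Qed.

(** The conditional probability of the event given [a] and [b1]. *)
Let h s (z : R * R) := distribution P b2 (xsection (Q s) z).

Let h_ge0 s z : (0 <= h s z)%E. Proof. exact: measure_ge0. Qed.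

Let measurable_h s : measurable_fun setT (h s).
Proof. exact: (measurable_fun_xsection (distribution P b2)). Qed.

Let measurable_h2 s x : measurable_fun setT (fun y => h s (x, y)).
Proof. exact: (measurable_fun_pair2 _ (measurable_h s)). Qed.

(** The event is unchanged when [b1] and [b2] both change sign, and the law of [b2] is symmetric; so
    the two sign halves contribute equally. *)
Let hN s x y : h s (x, - y) = h s (x, y).
Proof.
rewrite /h -[in RHS]distribution_b2N; last exact: measurable_xsection.
congr distribution; apply/seteqP; split => z; rewrite /xsection /=.
  by move=> /set_mem/=[]; rewrite mulNr => yz xyz; apply/mem_set; split; rewrite /= mulrN.
by move=> /set_mem/=[]; rewrite mulrN => yz xyz; apply/mem_set; split; rewrite /= mulNr.
Qed.

Let h_expR s x u : 0 < s -> (h s (x, expR u) =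
  \int[mu]_(r in `]0%R, s]) (if 2 * `|x| < r then
    g2 ((r ^+ 2 / 4 - x ^+ 2) * expR (- u)) * (r / 2 * expR (- u)) else 0)%:E)%E.
Proof.
move=> s0; rewrite /h xsection_Q density_b2//.
by rewrite integral_gauss_density_section// expR_gt0.
Qed.

(** By independence the probability is an iterated integral of [h] over [a] and [b1]. Writing [h]
    itself as an integral over the spacing [r] and moving [r] outermost exhibits the density. *)
Lemma spacing_measure_itvNyc s : 0 < s ->
  (spacing_measure a b1 b2 `]-oo, s] =
   \int[mu]_(r in `]0%R, s]) \int[mu]_x \int[mu]_u (spacing_kernel r x u)%:E)%E.
Proof.
move=> s0; rewrite spacing_measureE// (independent3_joint_law indep)//.
rewrite /product_measure1 /= -/(h s).
rewrite (fubini_tonelli1 (m1 := distribution P a) (m2 := distribution P b1) (h s))//.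
rewrite (ge0_integral_has_density density_a)//; last 4 first.
- exact: measurable_gauss_density.
- by move=> x; exact: gauss_density_ge0.
- exact: measurable_fun_fubini_tonelli_F.
- by move=> x; apply: integral_ge0.
(* The bound [r <= s] enters as an indicator, so that all three integrals run over the whole line
   and Tonelli applies. *)
pose k (z : R * R * R) := (spacing_kernel z.1.2 z.1.1 z.2 * \1_`]-oo, s] z.1.2)%:E.
have k_ge0 z : (0 <= k z)%E by rewrite lee_fin mulr_ge0// spacing_kernel_ge0.
have mk : measurable_fun setT k.
  apply/measurable_EFinP; apply: measurable_funM; first exact: measurable_spacing_kernel.
  apply: measurableT_comp => //.
  exact: (measurableT_comp measurable_snd measurable_fst).
transitivity (\int[mu]_x \int[mu]_u \int[mu]_r k ((x, r), u))%E.
  apply: eq_integral => x _; rewrite /fubini_F.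
  have mhx := measurable_h2 s x.
  have mhxe : measurable_fun setT (fun u => h s (x, expR u)).
    by apply: (measurableT_comp mhx); exact: measurable_expR.
  have mg1e : measurable_fun setT (fun u => (g1 (expR u))%:E).
    by apply/measurable_EFinP; exact: measurable_gauss_density_comp.
  have mge : measurable_fun setT (fun u => h s (x, expR u) * (g1 (expR u))%:E * (expR u)%:E)%E.
    by apply: emeasurable_funM; [exact: emeasurable_funM|exact/measurable_EFinP].
  have mhg : measurable_fun setT (fun y => h s (x, y) * (g1 y)%:E)%E.
    by apply: emeasurable_funM => //; apply/measurable_EFinP; exact: measurable_gauss_density.
  rewrite (ge0_integral_has_density density_b1)//; last 2 first.
  - exact: measurable_gauss_density.
  - by move=> y; exact: gauss_density_ge0.
  have hg_ge0 y : (0 <= h s (x, y) * (g1 y)%:E)%E.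
    by rewrite mule_ge0// lee_fin gauss_density_ge0.
  (* Evenness leaves only [b1 > 0], with a factor 2, and there [b1 = expR u]. *)
  rewrite ge0_integral_even//; last by move=> y; rewrite hN gauss_densityN.
  rewrite ge0_integral_substitution_exp//.
  rewrite -ge0_integralZl//; last by move=> u _; rewrite mule_ge0// lee_fin expR_ge0.
  have ga_ge0 : (0 <= (ga x)%:E)%E by rewrite lee_fin gauss_density_ge0.
  rewrite -ge0_integralZr//; last 2 first.
  - by apply: measurable_funeM.
  - by move=> u _; rewrite mule_ge0// mule_ge0// lee_fin expR_ge0.
  apply: eq_integral => u _.
  rewrite h_expR// integral_mkcond.
  set F := (X in (\int[_]_x X x * _ * _)%E).
  have F_ge0 r : (0 <= F r)%E.
    rewrite /F patchE; case: ifPn => //; rewrite inE/= in_itv/= => /andP[r0 _].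
    rewrite lee_fin; case: ifPn => // _.
    by rewrite mulr_ge0 ?gauss_density_ge0// mulr_ge0 ?expR_ge0// mulr_ge0// ltW.
  have g1_ge0 : (0 <= (g1 (expR u))%:E)%E by rewrite lee_fin gauss_density_ge0.
  have e_ge0 : (0 <= (expR u)%:E)%E by rewrite lee_fin expR_ge0.
  have mF : measurable_fun setT F.
    apply/(measurable_restrictT _ _).1 => //; apply/measurable_EFinP.
    apply: measurable_funTS; apply: measurable_fun_ifT => //.
      exact: measurable_fun_ltr.
    apply: measurable_funM; last by apply: measurable_funM => //; exact: measurable_funM.
    apply: measurable_gauss_density_comp; apply: measurable_funM => //.
    by apply: measurable_funB => //; apply: measurable_funM => //; exact: measurable_funX.
  have [H HF] : exists H, H = F by exists F.
  move: mF F_ge0; rewrite -HF => mF F_ge0.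
  have mF1 := @emeasurable_funM _ _ _ _ _ _ mF (measurable_cst (g1 (expR u))%:E).
  have mF2 := @emeasurable_funM _ _ _ _ _ _ mF1 (measurable_cst (expR u)%:E).
  have F1_ge0 r : (0 <= H r * (g1 (expR u))%:E)%E by rewrite mule_ge0.
  have F2_ge0 r : (0 <= H r * (g1 (expR u))%:E * (expR u)%:E)%E by rewrite mule_ge0.
  rewrite -ge0_integralZr// -ge0_integralZr// -ge0_integralZl// -ge0_integralZr//; last 2 first.
  - exact: measurable_funeM.
  - by move=> r _; rewrite mule_ge0.
  apply: eq_integral => r _; rewrite HF /k /F /spacing_kernel patchE/= indicE.
  have [xr|xr] := ltP (2 * `|x|) r; last first.
    by rewrite mul0r; case: ifPn => _; rewrite !(mul0e, mule0).
  have r0 : 0 < r by rewrite (le_lt_trans _ xr)// mulr_ge0.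
  (* The condition on [x] already forces [r > 0], so the two intervals cut out the same values of
     [r]. *)
  have -> : (r \in `]0, s]%classic) = (r \in `]-oo, s]%classic).
    by apply/idP/idP; rewrite !inE/= !in_itv/= r0.
  case: ifPn => _; last by rewrite mulr0 !(mul0e, mule0).
  rewrite -!EFinM; congr EFin; rewrite expRN.
  have := expR_gt0 u => /gt_eqF/negbT e0; set G2 := g2 _; set G1 := g1 _.
  by rewrite mulr1; field.
(* Tonelli moves [r] outermost, first past [u] and then past [x]. *)
transitivity (\int[mu]_x \int[mu]_r \int[mu]_u k ((x, r), u))%E.
  apply: eq_integral => x _.
  rewrite (fubini_tonelli (m1 := mu) (m2 := mu) (fun z => k ((x, z.2), z.1)))//.
  apply: (measurableT_comp mk); apply: measurable_fun_pair; last exact: measurable_fst.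
  by apply: measurable_fun_pair => //; exact: measurable_snd.
have mFk : measurable_fun setT (fubini_F mu k) by exact: measurable_fun_fubini_tonelli_F.
have Fk_ge0 z : (0 <= fubini_F mu k z)%E by apply: integral_ge0.
transitivity (\int[mu]_r \int[mu]_x fubini_F mu k (x, r))%E.
  exact: (fubini_tonelli (m1 := mu) (m2 := mu) (fubini_F mu k) mFk Fk_ge0).
rewrite /fubini_F.
rewrite [RHS]integral_mkcond; apply: eq_integral => r _; rewrite patchE.
case: ifPn => [|/negP rs].
  rewrite inE/= in_itv/= => /andP[_ rs]; apply: eq_integral => x _.
  apply: eq_integral => u _; rewrite /k/= indicE mem_set; first by rewrite /= mulr1.
  by rewrite /= in_itv/=.
apply: integral0_eq => x _; apply: integral0_eq => u _.
rewrite /k /spacing_kernel/= indicE; case: ifPn => [xr|_]; last by rewrite mul0r.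
have r0 : 0 < r by rewrite (le_lt_trans _ xr)// mulr_ge0.
have [|_] := boolP (r \in `]-oo, s]%classic); last by rewrite mulr0.
move=> /set_mem; rewrite /= in_itv/= => rs'; case: rs.
by apply/mem_set; rewrite /= in_itv/= r0.
Qed.

End spacing_law.

(** * The spacing density *)

Section spacing_integrand.
Context (R : realType) (sigma sigma1 sigma2 : R).
Hypotheses (sigma_gt0 : 0 < sigma) (sigma1_gt0 : 0 < sigma1).
Hypothesis sigma2_gt0 : 0 < sigma2.

Local Notation mu := (@lebesgue_measure R).
Local Notation ga := (gauss_density sigma).
Local Notation g1 := (gauss_density sigma1).
Local Notation g2 := (gauss_density sigma2).

Let ga_ge0 x : 0 <= ga x. Proof. exact: gauss_density_ge0. Qed.
Let g1_ge0 x : 0 <= g1 x. Proof. exact: gauss_density_ge0. Qed.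
Let g2_ge0 x : 0 <= g2 x. Proof. exact: gauss_density_ge0. Qed.
#[local] Hint Resolve ga_ge0 g1_ge0 g2_ge0 : core.

(* Here [z = (t, u)]; integrating in [u] alone gives a Bessel function K_0. *)
Definition bessel_integrand (k : R) (z : R * R) : R :=
  if `|z.1| < 1 then g1 (expR z.2) * g2 (k * (1 - z.1 ^+ 2) * expR (- z.2)) else 0.

Definition spacing_integrand (r : R) (z : R * R) : R :=
  ga (r / 2 * z.1) * bessel_integrand (r ^+ 2 / 4) z.

Lemma bessel_integrand_ge0 k z : 0 <= bessel_integrand k z.
Proof. by rewrite /bessel_integrand; case: ifPn => // _; rewrite mulr_ge0. Qed.

Lemma spacing_integrand_ge0 r z : 0 <= spacing_integrand r z.
Proof. by rewrite mulr_ge0// bessel_integrand_ge0. Qed.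

Lemma measurable_bessel_integrand k : measurable_fun setT (bessel_integrand k).
Proof.
apply: measurable_fun_ifT => //.
  by apply: measurable_fun_ltr => //; exact: measurableT_comp.
apply: measurable_funM; first by apply: measurable_gauss_density_comp; exact: measurableT_comp.
apply: measurable_gauss_density_comp; apply: measurable_funM.
  apply: measurable_funM => //; apply: measurable_funB => //.
  exact: measurable_funX.
by apply: measurableT_comp => //; exact: measurableT_comp.
Qed.

Lemma measurable_spacing_integrand r : measurable_fun setT (spacing_integrand r).
Proof.
apply: measurable_funM; last exact: measurable_bessel_integrand.
by apply: measurable_gauss_density_comp; exact: measurable_funM.
Qed.

Let one_subr_sqr_ge0 (x : R) : `|x| < 1 -> 0 <= 1 - x ^+ 2.
Proof.
by move=> x1; rewrite subr_ge0 -(real_normK (num_real x)) expr_le1// ltW.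
Qed.

Lemma bessel_integrand_le k k' z : 0 <= k -> k <= k' ->
  bessel_integrand k' z <= bessel_integrand k z.
Proof.
move=> k0 kk'; rewrite /bessel_integrand; case: ifPn => // z1.
apply: ler_wpM2l => //; apply: gauss_density_le => //.
rewrite !ger0_norm ?mulr_ge0 ?expR_ge0 ?one_subr_sqr_ge0//.
  by rewrite ler_wpM2r ?expR_ge0// ler_wpM2r// one_subr_sqr_ge0.
exact: le_trans kk'.
Qed.

Lemma spacing_integrand_ub r z :
  spacing_integrand r z <= ga 0 * bessel_integrand (r ^+ 2 / 4) z.
Proof.
apply: ler_wpM2r; first exact: bessel_integrand_ge0.
by apply: gauss_density_le => //; rewrite normr0.
Qed.

(** On the strip where [t] has absolute value below 1 the factor [ga] is at least [ga (r / 2) > 0];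
    so finiteness of the spacing integral passes to the Bessel integral. *)
Lemma spacing_integrand_lb r z : 0 < r ->
  ga (r / 2) * bessel_integrand (r ^+ 2 / 4) z <= spacing_integrand r z.
Proof.
move=> r0; rewrite /spacing_integrand /bessel_integrand.
case: ifPn => [z1|_]; last by rewrite !mulr0.
apply: ler_wpM2r; first by rewrite mulr_ge0.
by apply: gauss_density_le => //; rewrite normrM ler_piMr// ltW.
Qed.

(** The substitution [x = r / 2 * t] turns the condition on [x] into one on [t] alone; its Jacobian
    [r / 2] and the factor [r] of the kernel make up the prefactor. *)
Lemma integral_spacing_kernel r : 0 < r ->
  (\int[mu]_x \int[mu]_u (spacing_kernel sigma sigma1 sigma2 r x u)%:E =
   (r ^+ 2 / 2)%:E * \int[mu \x mu]_z (spacing_integrand r z)%:E)%E.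
Proof.
move=> r0; have r20 : 0 < r / 2 by rewrite divr_gt0.
pose k (z : R * R) := (spacing_kernel sigma sigma1 sigma2 r z.1 z.2)%:E.
have k_ge0 z : (0 <= k z)%E by rewrite lee_fin spacing_kernel_ge0.
have mk : measurable_fun setT k.
  have mz : measurable_fun setT (fun z : R * R => ((z.1, r), z.2)).
    by apply: measurable_fun_pair => //; exact: measurable_fun_pair.
  apply/measurable_EFinP.
  exact: (measurableT_comp (measurable_spacing_kernel sigma sigma1 sigma2) mz).
have mw : measurable_fun setT (fun z => (spacing_integrand r z)%:E).
  by apply/measurable_EFinP; exact: measurable_spacing_integrand.
have mFk : measurable_fun setT (fubini_F mu k) by exact: measurable_fun_fubini_tonelli_F.
transitivity (\int[mu]_x fubini_F mu k x)%E; first by [].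
rewrite (ge0_integral_substitution_scale r20)//; last first.
  by move=> x; apply: integral_ge0.
rewrite (fubini_tonelli1 (m1 := mu) (m2 := mu))//; last first.
  by move=> z; rewrite lee_fin spacing_integrand_ge0.
rewrite -ge0_integralZl//; last 3 first.
- apply: measurable_fun_fubini_tonelli_F => // z.
  by rewrite lee_fin spacing_integrand_ge0.
- by move=> x _; apply: integral_ge0 => u _; rewrite lee_fin spacing_integrand_ge0.
- by rewrite lee_fin divr_ge0// sqr_ge0.
apply: eq_integral => t _; rewrite /fubini_F.
rewrite -ge0_integralZr//; last 2 first.
- exact: (measurable_fun_pair2 _ mk).
- by rewrite lee_fin ltW.
rewrite -ge0_integralZl//; last 3 first.
- exact: (measurable_fun_pair2 _ mw).
- by move=> u _; rewrite lee_fin spacing_integrand_ge0.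
- by rewrite lee_fin divr_ge0// sqr_ge0.
apply: eq_integral => u _; rewrite /k /= -!EFinM; congr EFin.
rewrite /spacing_kernel /spacing_integrand /bessel_integrand/=.
have -> : (2 * `|r / 2 * t| < r) = (`|t| < 1).
  rewrite normrM (gtr0_norm r20) mulrA (_ : 2 * (r / 2) = r); last by field.
  by rewrite -[X in _ < X]mulr1 ltr_pM2l.
case: ifPn => _; last by rewrite mul0r !mulr0.
have -> : r ^+ 2 / 4 - (r / 2 * t) ^+ 2 = r ^+ 2 / 4 * (1 - t ^+ 2) by field.
by set A := ga _; set B := g1 _; set C := g2 _; field.
Qed.

(* The hypothesis says that the mass of the spacing law is finite: this yields one
   small [r] with a finite integral, and monotonicity does the rest. *)
Lemma bessel_integrable k :
  (forall s : R, (0 < s)%R -> \int[mu]_(r in `]0%R, s]) \int[mu]_x \int[mu]_u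
     (spacing_kernel sigma sigma1 sigma2 r x u)%:E < +oo)%E ->
  0 < k -> (mu \x mu)%E.-integrable setT (EFin \o bessel_integrand k).
Proof.
(* With [r <= s], both [r <= 1] and [r <= k] hold, whence [r ^+ 2 / 4 <= k]. *)
move=> fin k0; set s := Num.min 1 k.
have s0 : 0 < s by rewrite lt_min ltr01.
have [r] : exists r : R, [/\ 0 < r, r <= s &
    (\int[mu \x mu]_z (spacing_integrand r z)%:E < +oo)%E].
  (* Otherwise the integrand in [r] is infinite on all of []0, s]], an interval of positive length,
     and so is the mass. *)
  apply/not_existsP => H; have := fin _ s0; apply/negP; rewrite -leNgt.
  rewrite (_ : +oo%E = \int[mu]_(r in `]0%R, s]) +oo%E)%E; last first.
    have mus : mu `]0, s]%classic = s%:E.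
      by rewrite lebesgue_measure_itv/= lte_fin s0 sube0.
    apply/esym; transitivity (+oo * mu `]0%R, s]%classic)%E; first exact: integral_cst.
    by rewrite mus gt0_mulye// lte_fin.
  rewrite le_eqVlt; apply/orP; left; apply/eqP/eq_integral => r.
  rewrite inE/= in_itv/= => /andP[r0 rs]; rewrite integral_spacing_kernel//.
  have [+|] := ltP (\int[mu \x mu]_z (spacing_integrand r z)%:E)%E +oo%E.
    by move=> roo; case: (H r); split.
  rewrite leye_eq => /eqP ->; rewrite gt0_muley// lte_fin.
  by rewrite divr_gt0// exprn_gt0.
move=> [r0 rs roo].
have rk : r ^+ 2 / 4 <= k.
  have : s <= 1 by rewrite ge_min lexx.
  have : s <= k by rewrite ge_min lexx orbT.
  nra.
apply/integrableP; split; first by apply/measurable_EFinP; exact: measurable_bessel_integrand.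
have c0 : 0 < (ga (r / 2))^-1 by rewrite invr_gt0 gauss_density_gt0.
apply: (@le_lt_trans _ _ ((ga (r / 2))^-1%:E * \int[mu \x mu]_z (spacing_integrand r z)%:E)%E).
  rewrite -ge0_integralZl//; last 3 first.
  - by apply/measurable_EFinP; exact: measurable_spacing_integrand.
  - by move=> z _; rewrite lee_fin spacing_integrand_ge0.
  - by rewrite lee_fin ltW.
  apply: ge0_le_integral => //.
  - by do 2 apply: measurableT_comp => //; exact: measurable_bessel_integrand.
  - apply: measurable_funeM; apply/measurable_EFinP; exact: measurable_spacing_integrand.
  move=> z _; rewrite /= lee_fin ger0_norm ?bessel_integrand_ge0//.
  rewrite ler_pdivlMl ?gauss_density_gt0//.
  apply: le_trans (spacing_integrand_lb z r0); rewrite ler_wpM2l//.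
  by apply: bessel_integrand_le => //; rewrite divr_ge0// sqr_ge0.
by rewrite lte_mul_pinfty// lee_fin ltW.
Qed.

End spacing_integrand.

(** * Asymptotics at the origin *)

Section cvg_pinfty.
Context (R : realType).

Lemma cvg_expR_mul_pinfty (w : R) : 0 < w -> expR (c * w) @[c --> +oo] --> +oo.
Proof.
move=> w0; apply/cvgryPge => A; near=> c.
apply: (le_trans _ (expR_ge1Dx (c * w))).
have : A / w <= c by near: c; apply: nbhs_pinfty_ge; exact: num_real.
rewrite ler_pdivrMr//; lra.
Unshelve. all: by end_near. Qed.

Lemma cvg_expR_mul_ninfty (w : R) : w < 0 -> expR (c * w) @[c --> +oo] --> 0.
Proof.
move=> w0; rewrite (_ : (fun c => _) = fun c => (expR (c * - w))^-1); last first.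
  by apply/funext => c; rewrite -expRN mulrN opprK.
apply/(@gtr0_cvgV0 _ _ _ _ (fun c => expR (c * - w))).
  by apply: nearW => c; exact: expR_gt0.
by apply: cvg_expR_mul_pinfty; rewrite oppr_gt0.
Qed.

Lemma cvg_gauss_density_pinfty (s : R) : 0 < s ->
  gauss_density s x @[x --> +oo] --> 0.
Proof.
move=> s0; rewrite -[X in _ --> X](mulr0 (s * Num.sqrt pi)^-1).
apply: cvgM; first exact: cvg_cst.
apply: (@cvg_comp _ _ _ (fun x => x ^+ 2 / s ^+ 2) (fun y => expR (- y)) _ +oo); last first.
  exact: cvgr_expR.
apply/cvgryPge => A; near=> x.
have x1 : 1 <= x by near: x; apply: nbhs_pinfty_ge; exact: num_real.
have : A * s ^+ 2 <= x by near: x; apply: nbhs_pinfty_ge; exact: num_real.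
rewrite ler_pdivlMr ?exprn_gt0// => /le_trans; apply.
by rewrite expr2 ler_peMr// (le_trans ler01).
Unshelve. all: by end_near. Qed.

End cvg_pinfty.

Section spacing_density.
Context (R : realType) (sigma sigma1 sigma2 : R).
Hypotheses (sigma_gt0 : 0 < sigma) (sigma1_gt0 : 0 < sigma1).
Hypothesis sigma2_gt0 : 0 < sigma2.

Local Notation mu := (@lebesgue_measure R).
Local Notation ga := (gauss_density sigma).
Local Notation g1 := (gauss_density sigma1).
Local Notation g2 := (gauss_density sigma2).
Local Notation bessel_integrand := (bessel_integrand sigma1 sigma2).
Local Notation spacing_integrand := (spacing_integrand sigma sigma1 sigma2).

Hypothesis bessel_int :
  forall k, 0 < k -> (mu \x mu)%E.-integrable setT (EFin \o bessel_integrand k).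

Definition spacing_density (r : R) : R :=
  r ^+ 2 / 2 * (\int[(mu \x mu)%E]_z spacing_integrand r z)%R.

Let ga_ge0 x : 0 <= ga x. Proof. exact: gauss_density_ge0. Qed.
Let g1_ge0 x : 0 <= g1 x. Proof. exact: gauss_density_ge0. Qed.
Let g2_ge0 x : 0 <= g2 x. Proof. exact: gauss_density_ge0. Qed.

Lemma spacing_integrable r : 0 < r ->
  (mu \x mu)%E.-integrable setT (EFin \o spacing_integrand r).
Proof.
move=> r0.
refine (@le_integrable _ _ R (mu \x mu)%E setT measurableT _
  (fun z : R * R => (ga 0)%:E * (bessel_integrand (r ^+ 2 / 4) z)%:E)%E _ _ _).
- by apply/measurable_EFinP; exact: measurable_spacing_integrand.
- move=> z _; have ub := spacing_integrand_ub sigma_gt0 sigma1_gt0 sigma2_gt0 r z.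
  have lb := spacing_integrand_ge0 sigma_gt0 sigma1_gt0 sigma2_gt0 r z.
  rewrite -EFinM lee_fin (ger0_norm lb) ger0_norm//.
  exact: le_trans ub.
- by apply: integrableZl => //; apply: bessel_int; rewrite divr_gt0// exprn_gt0.
Qed.

Lemma spacing_density_ge0 r : 0 <= spacing_density r.
Proof.
rewrite mulr_ge0 ?divr_ge0 ?sqr_ge0//; apply: Rintegral_ge0 => z _.
exact: spacing_integrand_ge0.
Qed.

(** Integrability rules out the default value that a real integral takes when the extended one is
    infinite. *)
Lemma spacing_densityE r : 0 < r ->
  ((spacing_density r)%:E =
   (r ^+ 2 / 2)%:E * \int[mu \x mu]_z (spacing_integrand r z)%:E)%E.
Proof.
move=> r0; rewrite /spacing_density EFinM /Rintegral fineK//.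
exact: (integrable_fin_num _ (spacing_integrable r0)).
Qed.

Let continuous_bessel_integrand z : continuous (bessel_integrand ^~ z).
Proof.
move=> k; have [z1|z1] := ltP `|z.1| 1; last first.
  rewrite (_ : bessel_integrand ^~ z = cst 0); first exact: cst_continuous.
  by apply/funext => l; rewrite /bessel_integrand ltNge z1.
rewrite (_ : bessel_integrand ^~ z = fun l =>
    g1 (expR z.2) * g2 (l * (1 - z.1 ^+ 2) * expR (- z.2))); last first.
  by apply/funext => l; rewrite /bessel_integrand z1.
pose f (l : R) := l * (1 - z.1 ^+ 2) * expR (- z.2).
have cf : continuous f.
  move=> l; apply: cvgM; last exact: cvg_cst.
  by apply: cvgM; [exact: cvg_id|exact: cvg_cst].
have cg : continuous (g2 \o f).
  by move=> l; apply: continuous_comp; [exact: cf|exact: continuous_gauss_density].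
by apply: cvgM; [exact: cvg_cst|exact: cg].
Qed.

Let continuous_spacing_integrand z : continuous (spacing_integrand ^~ z).
Proof.
pose f (r : R) := r / 2 * z.1.
have cf : continuous f.
  move=> r; apply: cvgM; last exact: cvg_cst.
  by apply: cvgM; [exact: cvg_id|exact: cvg_cst].
have cga : continuous (ga \o f).
  by move=> r; apply: continuous_comp; [exact: cf|exact: continuous_gauss_density].
pose h (r : R) := r ^+ 2 / 4.
have ch : continuous h.
  by move=> r; apply: cvgM; [exact: exprn_continuous|exact: cvg_cst].
have cb : continuous ((bessel_integrand ^~ z) \o h).
  by move=> r; apply: continuous_comp; [exact: ch|exact: continuous_bessel_integrand].
by move=> r; apply: cvgM; [exact: cga|exact: cb].
Qed.

(** Dominated convergence on [](s / 2), (s + 1)[]: as the Bessel integrand decreases in [r], its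
    value at the left end, times [ga 0], dominates throughout. *)
Lemma continuous_spacing_density s : 0 < s -> {for s, continuous spacing_density}.
Proof.
move=> s0; have s20 : 0 < s / 2 by rewrite divr_gt0.
have sI : s \in `](s / 2), (s + 1)[%classic.
  by rewrite inE/= in_itv/=; apply/andP; split; lra.
have cI : {for s, continuous (fun l => (\int[(mu \x mu)%E]_z spacing_integrand l z)%R)}.
  refine (@continuity_under_integral R _ _ (mu \x mu)%E spacing_integrand setT
    measurableT (s / 2) (s + 1) _ _ (fun z : R * R =>
    ga 0 * bessel_integrand ((s / 2) ^+ 2 / 4) z) _ _ s sI).
  - move=> x; rewrite /= in_itv/= => /andP[sx _]; apply: spacing_integrable.
    exact: lt_trans sx.
  - by apply: aeW => z _ x _; exact: continuous_spacing_integrand.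
  - rewrite (_ : _ \o _ = fun z => (ga 0)%:E * (bessel_integrand ((s / 2) ^+ 2 / 4) z)%:E)%E//.
    by apply: integrableZl => //; apply: bessel_int; rewrite divr_gt0// exprn_gt0.
  - move=> x; rewrite /= in_itv/= => /andP[sx _]; apply: aeW => z _.
    rewrite ger0_norm ?spacing_integrand_ge0//.
    apply: (le_trans (spacing_integrand_ub _ _ _ _ _)) => //.
    rewrite ler_wpM2l// bessel_integrand_le// ?divr_ge0 ?sqr_ge0//.
    by rewrite ler_pM2r// lerXn2r ?nnegrE ?(ltW s20)// ltW// (lt_trans s20).
apply: cvgM; last exact: cI.
by apply: cvgM; [exact: exprn_continuous|exact: cvg_cst].
Qed.

(* The substitutions [r = expR (- (c / 2))], i.e. [c = ln (r ^- 2)], and [u = c * v]. *)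
Let scaled (c : R) (z : R * R) : R :=
  spacing_integrand (expR (- (c / 2))) (z.1, c * z.2).

Let scaled_ge0 c z : 0 <= scaled c z.
Proof. exact: spacing_integrand_ge0. Qed.

Let measurable_scaled c : measurable_fun setT (scaled c).
Proof.
have mz : measurable_fun setT (fun z : R * R => (z.1, c * z.2)).
  by apply: measurable_fun_pair => //; exact: measurable_funM.
exact: (measurableT_comp (measurable_spacing_integrand sigma sigma1 sigma2 _) mz).
Qed.

Let integral_scaled c : 0 < c ->
  (\int[mu \x mu]_z (spacing_integrand (expR (- (c / 2))) z)%:E =
   c%:E * \int[mu \x mu]_z (scaled c z)%:E)%E.
Proof.
move=> c0; set r := expR _.
have mw : measurable_fun setT (fun z => (spacing_integrand r z)%:E).
  by apply/measurable_EFinP; exact: measurable_spacing_integrand.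
have ms : measurable_fun setT (fun z => (scaled c z)%:E).
  by apply/measurable_EFinP; exact: measurable_scaled.
have w_ge0 z : (0 <= (spacing_integrand r z)%:E)%E.
  by rewrite lee_fin spacing_integrand_ge0.
have s_ge0 z : (0 <= (scaled c z)%:E)%E by rewrite lee_fin.
rewrite (fubini_tonelli1 (m1 := mu) (m2 := mu) _ mw w_ge0).
rewrite (fubini_tonelli1 (m1 := mu) (m2 := mu) _ ms s_ge0).
rewrite -ge0_integralZl//; last 3 first.
- exact: measurable_fun_fubini_tonelli_F.
- by move=> x _; apply: integral_ge0.
- by rewrite lee_fin ltW.
apply: eq_integral => t _; rewrite /fubini_F.
rewrite (ge0_integral_substitution_scale c0)//; last exact: (measurable_fun_pair2 _ mw).
rewrite -ge0_integralZl//; last 2 first.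
- exact: (measurable_fun_pair2 _ ms).
- by rewrite lee_fin ltW.
by apply: eq_integral => u _; rewrite muleC.
Qed.

Let scaledE c t v : `|t| < 1 -> scaled c (t, v) =
  ga (expR (- (c / 2)) / 2 * t) *
  (g1 (expR (c * v)) * g2 ((1 - t ^+ 2) / 4 * expR (c * - (1 + v)))).
Proof.
move=> t1; rewrite /scaled /spacing_integrand /bessel_integrand/= t1.
(* The two terms [- (c / 2)] come from [r ^+ 2], and [- c * v] from [expR (- u)]. *)
congr (_ * (_ * g2 _)); rewrite (_ : c * - (1 + v) = - (c / 2) + - (c / 2) - c * v); last by field.
by rewrite !expRD; field.
Qed.

(** Each ratio bounds the loss of one Gaussian factor when [c] is replaced by 1. *)
Let C := (g1 0 / g1 1) * (g2 0 / g2 1).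

(** For [0 <= v], increasing [c] moves the argument away from 0. For [v < 0], the left side is at
    most [g1 0], while [expR v <= 1] gives [g1 1 <= g1 (expR v)]. *)
Let g1_scale (c v : R) : 1 <= c -> g1 (expR (c * v)) <= g1 0 / g1 1 * g1 (expR v).
Proof.
move=> c1; have [v0|v0] := leP 0 v.
  apply: (@le_trans _ _ (g1 (expR v))).
    by rewrite gauss_density_le// !ger0_norm ?expR_ge0// ler_expR ler_peMl.
  rewrite ler_peMl// ler_pdivlMr ?gauss_density_gt0// mul1r.
  by rewrite gauss_density_le// normr0.
apply: (@le_trans _ _ (g1 0)); first by rewrite gauss_density_le// normr0.
rewrite mulrAC ler_pdivlMr ?gauss_density_gt0// ler_wpM2l//.
by rewrite gauss_density_le// !ger0_norm ?expR_ge0// -expR0 ler_expR ltW.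
Qed.

(** The same two cases, with [k <= 1] keeping [k * expR w] below 1 when [w < 0]. *)
Let g2_scale (k c w : R) : 0 <= k -> k <= 1 -> 1 <= c ->
  g2 (k * expR (c * w)) <= g2 0 / g2 1 * g2 (k * expR w).
Proof.
move=> k0 k1 c1; have [w0|w0] := leP 0 w.
  apply: (@le_trans _ _ (g2 (k * expR w))).
    rewrite gauss_density_le// !ger0_norm ?mulr_ge0 ?expR_ge0//.
    by rewrite ler_wpM2l// ler_expR ler_peMl.
  rewrite ler_peMl// ler_pdivlMr ?gauss_density_gt0// mul1r.
  by rewrite gauss_density_le// normr0.
apply: (@le_trans _ _ (g2 0)); first by rewrite gauss_density_le// normr0.
rewrite mulrAC ler_pdivlMr ?gauss_density_gt0// ler_wpM2l//.
rewrite gauss_density_le// !ger0_norm ?mulr_ge0 ?expR_ge0//.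
by rewrite mulr_ile1 ?expR_ge0// -expR0 ler_expR ltW.
Qed.

(** The bound is uniform in [c]. At [c = 1] the argument of [g2] is that of the Bessel integrand
    with parameter [expR (- 1) / 4]. *)
Let scaled_ub c z : 1 <= c ->
  scaled c z <= ga 0 * C * bessel_integrand (expR (- 1) / 4) z.
Proof.
move=> c1; case: z => t v; have [t1|t1] := ltP `|t| 1; last first.
  by rewrite /scaled /spacing_integrand /bessel_integrand/= ltNge t1 !mulr0.
rewrite scaledE// /bessel_integrand/= t1 -(mulrA (ga 0)).
have t2 : 0 <= (1 - t ^+ 2) / 4 <= 1.
  rewrite divr_ge0//=; last by rewrite subr_ge0 -(real_normK (num_real t)) expr_le1// ltW.
  by rewrite ler_pdivrMr// mul1r; have := sqr_ge0 t; lra.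
case/andP: t2 => t2 t3.
apply: ler_pM; [by []|exact: mulr_ge0| |].
  by apply: gauss_density_le => //; rewrite normr0.
rewrite /C [leRHS]mulrACA; apply: ler_pM; [by []|by []|exact: g1_scale|].
apply: (le_trans (g2_scale _ _ _ _)) => //.
rewrite (_ : (1 - t ^+ 2) / 4 * expR (- (1 + v)) =
  expR (- 1) / 4 * (1 - t ^+ 2) * expR (- v))//.
by rewrite opprD expRD; field.
Qed.

(** The argument of [g1] tends to 0 or to infinity according to the sign of [v], that of [g2]
    according to the sign of [1 + v]; both factors survive only for [-1 < v < 0]. At the excluded
    [v] one of the two arguments does not depend on [c]. *)
Let scaled_cvg t v : v != 0 -> v != -1 ->
  scaled c (t, v) @[c --> +oo] -->
  ga 0 * g1 0 * g2 0 * \1_(`]-1, 1[ `*` `]-1, 0[) (t, v).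
Proof.
move=> v0 v1; have [t1|t1] := ltP `|t| 1; last first.
  rewrite (_ : (fun c => _) = cst 0); last first.
    by apply/funext => c; rewrite /scaled /spacing_integrand /bessel_integrand/= ltNge t1 !mulr0.
  rewrite indicE memNset ?mulr0; first exact: cvg_cst.
  by move=> [/=]; rewrite in_itv/= -ltr_norml ltNge t1.
rewrite (_ : (fun c => _) = (fun c => ga (expR (- (c / 2)) / 2 * t) *
  (g1 (expR (c * v)) * g2 ((1 - t ^+ 2) / 4 * expR (c * - (1 + v)))))); last first.
  by apply/funext => c; exact: scaledE.
have k0 : 0 < (1 - t ^+ 2) / 4.
  by rewrite divr_gt0// subr_gt0 -(real_normK (num_real t)) expr_lt1.
have ca : ga (expR (- (c / 2)) / 2 * t) @[c --> +oo] --> ga 0.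
  have e0 : expR (- (c / 2)) @[c --> +oo] --> (0 : R).
    rewrite (_ : (fun c => _) = fun c => expR (c * - 2^-1)).
      by apply: cvg_expR_mul_ninfty; rewrite oppr_lt0.
    by apply/funext => c; rewrite mulrN.
  have f0 : expR (- (c / 2)) / 2 * t @[c --> +oo] --> (0 : R).
    rewrite -[X in _ --> X](mul0r t); apply: cvgM; last exact: cvg_cst.
    by rewrite -[X in _ --> X](mul0r 2^-1); apply: cvgM; last exact: cvg_cst.
  exact: (cvg_comp _ _ f0 (@continuous_gauss_density R sigma 0)).
have c1 : g1 (expR (c * v)) @[c --> +oo] --> (if v < 0 then g1 0 else 0).
  case: ifPn => vn.
    exact: (cvg_comp _ _ (cvg_expR_mul_ninfty vn) (@continuous_gauss_density R sigma1 0)).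
  have vp : 0 < v by rewrite lt_neqAle eq_sym v0 leNgt.
  exact: (cvg_comp _ _ (cvg_expR_mul_pinfty vp) (cvg_gauss_density_pinfty sigma1_gt0)).
have c2 : g2 ((1 - t ^+ 2) / 4 * expR (c * - (1 + v))) @[c --> +oo] -->
    (if -1 < v then g2 0 else 0).
  case: ifPn => vn.
    have w0 : - (1 + v) < 0 by lra.
    have f0 : (1 - t ^+ 2) / 4 * expR (c * - (1 + v)) @[c --> +oo] --> (0 : R).
      rewrite -[X in _ --> X](mulr0 ((1 - t ^+ 2) / 4)); apply: cvgM; first exact: cvg_cst.
      exact: cvg_expR_mul_ninfty.
    exact: (cvg_comp _ _ f0 (@continuous_gauss_density R sigma2 0)).
  have w0 : 0 < - (1 + v).
    by move: vn; rewrite -leNgt le_eqVlt (negbTE v1)/=; lra.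
  have foo : (1 - t ^+ 2) / 4 * expR (c * - (1 + v)) @[c --> +oo] --> +oo.
    by apply: gt0_cvgMry => //; exact: cvg_expR_mul_pinfty.
  exact: (cvg_comp _ _ foo (cvg_gauss_density_pinfty sigma2_gt0)).
have -> : ga 0 * g1 0 * g2 0 * \1_(`]-1, 1[ `*` `]-1, 0[) (t, v) =
    ga 0 * ((if v < 0 then g1 0 else 0) * (if -1 < v then g2 0 else 0)).
  rewrite indicE; case: ifPn => vn; case: ifPn => vp.
  - rewrite mem_set ?mulr1 -?mulrA// ; split => /=; rewrite in_itv/= ?vp//.
    by rewrite -ltr_norml.
  - rewrite memNset ?mulr0// => -[_ /=]; rewrite in_itv/= => /andP[vp' _].
    by rewrite vp' in vp.
  - rewrite memNset ?mulr0 ?mul0r ?mulr0// => -[_ /=]; rewrite in_itv/= => /andP[_ vn'].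
    by rewrite vn' in vn.
  - rewrite memNset ?mulr0 ?mul0r ?mulr0// => -[_ /=]; rewrite in_itv/= => /andP[_ vn'].
    by rewrite vn' in vn.
by apply: cvgM => //; exact: cvgM.
Qed.

(** Dominated convergence; the factor 2 is the area of the rectangle on which the limit is
    nonzero. *)
Let integral_scaled_cvg (u : R^nat) : (forall n, 1 <= u n) -> u n @[n --> \oo] --> +oo ->
  (\int[mu \x mu]_z (scaled (u n) z)%:E @[n --> \oo] --> (2 * (ga 0 * g1 0 * g2 0))%:E)%E.
Proof.
move=> u1 uoo; pose K := ga 0 * g1 0 * g2 0.
pose D : set (R * R) := `]-1, 1[ `*` `]-1, 0[.
have mD : measurable D by exact: measurableX.
have K0 : 0 <= K by rewrite mulr_ge0// mulr_ge0.
have -> : ((2 * K)%:E = \int[mu \x mu]_z (K * \1_D z)%:E)%E.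
  have muD : ((mu \x mu) D = 2%:E)%E.
    rewrite product_measure1E//= !lebesgue_measure_itv/= !lte_fin.
    by rewrite ltrN10 (_ : -1 < 1 :> R)//= -?EFinM -?EFinB -?EFinD -?EFinM; congr EFin; ring.
  under eq_integral do rewrite EFinM.
  rewrite ge0_integralZl//; last exact/measurable_EFinP.
  have -> : (\int[mu \x mu]_z (\1_D z)%:E = (mu \x mu) D)%E by rewrite integral_indic// setIT.
  by rewrite muD -EFinM mulrC.
have ms n : measurable_fun setT (fun z => (scaled (u n) z)%:E).
  by apply/measurable_EFinP; exact: measurable_scaled.
have mN : measurable [set 0; -1 : R] by exact: measurableU.
(* The two lines on which the pointwise limit was not established are negligible. *)
have muN : ((mu \x mu) (setT `*` [set 0%R; (-1)%R]) = 0)%E.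
  have mu0 : mu [set 0%R; (-1)%R] = 0%E.
    by apply: countable_lebesgue_measure0; exact: finite_set_countable.
  transitivity (mu setT * mu [set 0%R; (-1)%R])%E; first exact: product_measure1E.
  by rewrite mu0 mule0.
have [||||_ _ H] := @dominated_convergence _ _ R (mu \x mu)%E setT measurableT
  (fun n z => (scaled (u n) z)%:E) (fun z => (K * \1_D z)%:E)
  (fun z => (ga 0 * C)%:E * (bessel_integrand (expR (- 1) / 4) z)%:E)%E ms; last exact: H.
- by apply/measurable_EFinP; exact: measurable_funM.
- exists (setT `*` [set 0; -1]); split.
  + exact: measurableX.
  + exact: muN.
  + move=> [t v] /=; apply: contra_notP => /not_andP[//|H] _.
    have v0 : v != 0 by apply/eqP => v0; apply: H; left.
    have v1 : v != -1 by apply/eqP => v1; apply: H; right.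
    apply: cvg_EFin; first exact: nearW.
    exact: (cvg_comp _ _ uoo (scaled_cvg v0 v1)).
- apply: integrableZl => //; apply: bessel_int.
  by rewrite divr_gt0// expR_gt0.
- by apply: aeW => z n _; rewrite /= lee_fin ger0_norm// scaled_ub.
Qed.

(** Along a sequence [u n] tending to 0 from the right, with [c n = ln (u n ^- 2)], the quotient is
    half the integral of [scaled (c n)]. *)
Lemma spacing_density_asymp :
  spacing_density S / (S ^+ 2 * ln (S ^- 2)) @[S --> 0^'+] --> ga 0 * g1 0 * g2 0.
Proof.
apply/cvg_at_rightP => u [u0 ucvg].
pose c n := ln (u n ^- 2).
have cE n : expR (- (c n / 2)) = u n.
  rewrite /c lnV ?posrE ?exprn_gt0// lnXn// -[ln (u n) *+ 2]mulr_natr.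
  by rewrite mulNr opprK mulfK// lnK// posrE.
have coo : c n @[n --> \oo] --> +oo.
  apply/cvgryPge => A; have eA : 0 < expR (- (A / 2)) by exact: expR_gt0.
  near=> n; have : u n <= expR (- (A / 2)) by near: n; exact: (cvgr_le _ ucvg).
  by rewrite -cE ler_expR lerN2 ler_pM2r.
(* The uniform bound requires [1 <= c] at every index; [c'] satisfies this and eventually equals
   [c]. *)
pose c' n := Num.max 1 (c n).
have c'oo : c' n @[n --> \oo] --> +oo.
  apply/cvgryPge => A; near=> n; rewrite le_max; apply/orP; right.
  by near: n; move/cvgryPge : coo; exact.
have c'1 n : 1 <= c' n by rewrite le_max lexx.
have H := integral_scaled_cvg c'1 c'oo.
(* The 1/2 in the prefactor [r ^+ 2 / 2] cancels the area 2. *)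
have {}H : ((2^-1)%:E * \int[mu \x mu]_z (scaled (c' n) z)%:E @[n --> \oo] -->
    (2^-1)%:E * (2 * (ga 0 * g1 0 * g2 0))%:E)%E.
  by apply: cvgeZl.
rewrite -EFinM mulKf// in H.
move/fine_cvg : H; apply: cvg_trans; apply: near_eq_cvg.
near=> n; have c1 : 1 <= c n by near: n; move/cvgryPge : coo; exact.
have c0 : 0 < c n by rewrite (lt_le_trans ltr01).
have sge0 z : (0 <= (scaled (c n) z)%:E)%E by rewrite lee_fin.
have pE : (spacing_density (u n))%:E =
    ((u n ^+ 2 / 2)%:E * ((c n)%:E * \int[mu \x mu]_z (scaled (c n) z)%:E))%E.
  by rewrite spacing_densityE// -{2}(cE n) integral_scaled.
(* The left side of [pE] is a real number, so the integral cannot be infinite. *)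
have fin : (\int[mu \x mu]_z (scaled (c n) z)%:E)%E \is a fin_num.
  rewrite ge0_fin_numE ?integral_ge0// ltNge leye_eq; apply/negP => /eqP I.
  move: pE; rewrite I gt0_muley ?lte_fin// gt0_muley// lte_fin.
  by rewrite divr_gt0// exprn_gt0.
have [i iE] : exists i : R, (\int[mu \x mu]_z (scaled (c n) z)%:E)%E = i%:E.
  by eexists; rewrite -(fineK fin).
rewrite /= /c' (max_idPr c1) iE -EFinM/=.
move: pE; rewrite iE -!EFinM => -[->]; rewrite -/(c n).
have un0 : u n != 0 by rewrite gt_eqF.
have cn0 : c n != 0 by rewrite gt_eqF.
by field; rewrite un0 cn0.
Unshelve. all: by end_near. Qed.

End spacing_density.

(** * Uniqueness of a continuous density *)

(** If [q s < p s], continuity separates the two functions by constants on a small interval around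
    [s], and their integrals over it differ. Applied in both directions, this gives equality. *)
Lemma le_continuous_density (R : realType) (p q : R -> R) :
  (forall s, 0 < s -> {for s, continuous p}) ->
  (forall s, 0 < s -> {for s, continuous q}) ->
  (forall s, 0 < s -> 0 <= p s) -> (forall s, 0 < s -> 0 <= q s) ->
  (forall E : set R, measurable E -> E `<=` `]0, +oo[ ->
    (\int[lebesgue_measure]_(s in E) (p s)%:E = \int[lebesgue_measure]_(s in E) (q s)%:E)%E) ->
  forall s, 0 < s -> p s <= q s.
Proof.
move=> cp cq p0 q0 pq s s0; rewrite leNgt; apply/negP => qp.
(* The points at one third and two thirds of the way from [q s] to [p s]. *)
pose k := (2 * q s + p s) / 3; pose l := (q s + 2 * p s) / 3.
have kl : k < l by rewrite /k /l; lra.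
have : \forall x \near s, [/\ 0 < x, q x <= k & l <= p x].
  near=> x; split.
  - by near: x; exact: (cvgr_gt s cvg_id).
  - by near: x; apply: (cvgr_le _ (cq s s0)); rewrite /k; lra.
  - by near: x; apply: (cvgr_ge _ (cp s s0)); rewrite /l; lra.
move=> /nbhs_ballP[e /= e0 se].
pose E : set R := `](s - e), (s + e)[%classic.
have Ese x : E x -> [/\ 0 < x, q x <= k & l <= p x].
  rewrite /E /= => xE; apply: se; rewrite /ball/= distrC.
  by move: xE; rewrite in_itv/= => /andP[? ?]; rewrite ltr_norml; apply/andP; split; lra.
have E0 : E `<=` `]0, +oo[ by move=> x /Ese[x0 _ _]; rewrite /= in_itv/= x0.
have mE : measurable E by exact: measurable_itv.
have oE : open E by exact: interval_open.
have muE : lebesgue_measure E = (2 * e)%:E.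
  rewrite lebesgue_measure_itv/= lte_fin ifT; last lra.
  by rewrite -EFinB; congr EFin; ring.
have mq : measurable_fun E (EFin \o q).
  apply/measurable_EFinP; apply: open_continuous_measurable_fun => //.
  by move=> x; rewrite inE => /Ese[x0 _ _]; exact: cq.
have mp : measurable_fun E (EFin \o p).
  apply/measurable_EFinP; apply: open_continuous_measurable_fun => //.
  by move=> x; rewrite inE => /Ese[x0 _ _]; exact: cp.
have k0 : 0 <= k.
  by have := q0 s s0; have := p0 s s0; rewrite /k; lra.
have qk : (\int[lebesgue_measure]_(x in E) (q x)%:E <= (k * (2 * e))%:E)%E.
  rewrite EFinM -muE -integral_cst//; apply: ge0_le_integral => //.
  - by move=> x /Ese[x0 _ _]; rewrite lee_fin q0.
  - by move=> x /Ese[_ qx _]; rewrite lee_fin.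
have pl : ((l * (2 * e))%:E <= \int[lebesgue_measure]_(x in E) (p x)%:E)%E.
  rewrite EFinM -muE -integral_cst//; apply: ge0_le_integral => //.
  - by move=> x _; rewrite lee_fin (le_trans k0)// ltW.
  - by move=> x /Ese[_ _ px]; rewrite lee_fin.
have := le_trans pl (le_trans _ qk); rewrite pq// => /(_ (lexx _)).
rewrite lee_fin ler_pM2r; last lra.
by rewrite leNgt kl.
Unshelve. all: by end_near. Qed.

(** * Existence of the continuous spacing density *)

Section continuous_density.
Context d (T : measurableType d) (R : realType) (P : probability T R).
Variables (a b1 b2 : {RV P >-> R}) (sigma sigma1 sigma2 : R).
Hypotheses (sigma_gt0 : 0 < sigma) (sigma1_gt0 : 0 < sigma1).
Hypothesis sigma2_gt0 : 0 < sigma2.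
Hypothesis indep : independent3 a b1 b2.
Hypothesis density_a : has_density a (gauss_density sigma).
Hypothesis density_b1 : has_density b1 (gauss_density sigma1).
Hypothesis density_b2 : has_density b2 (gauss_density sigma2).

Local Notation mu := (@lebesgue_measure R).
Local Notation density := (spacing_density sigma sigma1 sigma2).

Let level w := level_spacing (a w) (b1 w) (b2 w).

Let measurable_same_sign : measurable [set w | 0 < b1 w * b2 w].
Proof.
have m12 : measurable_fun setT (fun w => b1 w * b2 w) by exact: measurable_funM.
rewrite (_ : [set w | _] = setT `&` (fun w => b1 w * b2 w) @^-1` `]0, +oo[).
  exact: m12.
by rewrite setTI; apply/seteqP; split=> w /=; rewrite in_itv/= andbT.
Qed.

Let measurable_level : measurable_fun setT (level : T -> measurableTypeR R).
Proof.
have mS : measurable_fun setT (fun w => a w ^+ 2 + b1 w * b2 w).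
  by apply: measurable_funD; [exact: measurable_funX|exact: measurable_funM].
have msqrt : measurable_fun setT (@Num.sqrt R).
  by apply: continuous_measurable_fun; exact: sqrt_continuous.
have ml : measurable_fun setT (level : T -> R).
  by apply: measurable_funM => //; exact: (measurableT_comp msqrt mS).
exact: ml.
Qed.

(** The spacing law as a genuine measure: the image of [P], restricted to the same-sign event, under
    the spacing. *)
Let m : {measure set (measurableTypeR R) -> \bar R} :=
  pushforward_measure
    (mrestr P measurable_same_sign) measurable_level.

Let mE E : spacing_measure a b1 b2 E = m E.
Proof.
rewrite /spacing_measure /= /pushforward /mrestr; congr (P _).
by apply/seteqP; split=> w /= [? ?].
Qed.

Let m_le1 E : measurable E -> (m E <= 1)%E.
Proof.
move=> mE'; rewrite /= /pushforward /mrestr; apply: probability_le1.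
apply: measurableI => //; rewrite -[X in measurable X]setTI; exact: measurable_level.
Qed.

(** The random variables themselves supply the finiteness: the integral over []0, s]] is a
    probability. *)
Lemma bessel_integrable_of_law k : 0 < k ->
  (mu \x mu)%E.-integrable setT (EFin \o bessel_integrand sigma1 sigma2 k).
Proof.
move=> k0; apply: (@bessel_integrable R sigma) => // s s0.
rewrite -(spacing_measure_itvNyc sigma_gt0 sigma1_gt0 sigma2_gt0 indep
  density_a density_b1 density_b2 s0) mE.
by apply: (le_lt_trans (m_le1 _)) => //; rewrite ltry.
Qed.

(** The spacing law and the measure with this density have the same distribution function, hence
    coincide. *)
Lemma is_continuous_spacing_density_spacing_density :
  is_continuous_spacing_density a b1 b2 density.
Proof.
have bint := bessel_integrable_of_law.
have cd s : 0 < s -> {for s, continuous density}.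
  by move=> s0; exact: continuous_spacing_density.
split=> //; first by move=> s _; exact: spacing_density_ge0.
(* The density is cut off to the positive half-line, where its continuity is known, to obtain a
   measure on the whole line. *)
have mq : measurable_fun setT (density \_ `]0, +oo[).
  apply/(measurable_restrictT _ _).1 => //; apply: open_continuous_measurable_fun => //.
  by move=> s; rewrite inE/= in_itv/= andbT; exact: cd.
have q0 s : 0 <= (density \_ `]0, +oo[) s.
  by rewrite patchE; case: ifPn => // _; exact: spacing_density_ge0.
have mm2 E : measurable E -> m E = density_measure mu mq q0 E.
  apply: finite_measure_unique_itvNyc; first by apply: (le_lt_trans (m_le1 _)) => //; rewrite ltry.
  move=> s; rewrite -mE; have [s0|s0] := ltP 0 s.
    rewrite (spacing_measure_itvNyc sigma_gt0 sigma1_gt0 sigma2_gt0 indep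
      density_a density_b1 density_b2 s0).
    rewrite /= /density_measure [LHS]integral_mkcond [RHS]integral_mkcond.
    apply: eq_integral => r _; rewrite !patchE.
    have [r0|r0] := ltP 0 r.
      rewrite !mem_setE !in_itv/= r0/=; case: ifPn => // rs.
      by rewrite integral_spacing_kernel// spacing_densityE.
    rewrite !mem_setE !in_itv/= ltNge r0/=.
    by case: ifPn.
  (* For [s <= 0] both sides vanish: the cut-off density is zero there, and the spacing is positive
     whenever [b1 * b2 > 0]. *)
  rewrite /= /density_measure [RHS]integral0_eq; last first.
    move=> r /=; rewrite in_itv/= => rs; rewrite patchE memNset//= in_itv/= andbT.
    by apply/negP; rewrite -leNgt (le_trans rs).
  rewrite /spacing_measure (_ : [set w | _] = set0) ?measure0//.
  apply/seteqP; split=> // w /= [b0]; rewrite in_itv/= /level_spacing => ls.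
  have : 0 < 2 * Num.sqrt (a w ^+ 2 + b1 w * b2 w).
    by rewrite mulr_gt0// sqrtr_gt0 ltr_wpDl// sqr_ge0.
  by rewrite ltNge (le_trans ls).
move=> E mE' E0; rewrite mE mm2//.
apply: eq_integral => s /set_mem /E0 s0.
by rewrite patchE mem_set.
Qed.

End continuous_density.

Theorem mainTheorem3 (R : realType) (d : measure_display)
    (T : measurableType d) (P : probability T R) (a b1 b2 : {RV P >-> R})
    (sigma sigma1 sigma2 : R)
    (sigma_gt0 : 0 < sigma) (sigma1_gt0 : 0 < sigma1) (sigma2_gt0 : 0 < sigma2)
    (indep : independent3 a b1 b2)
    (density_a : has_density a (gauss_density sigma))
    (density_b1 : has_density b1 (gauss_density sigma1))
    (density_b2 : has_density b2 (gauss_density sigma2)) :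
  (exists p : R -> R, is_continuous_spacing_density a b1 b2 p) /\
  (forall p : R -> R, is_continuous_spacing_density a b1 b2 p ->
    exists c : R, 0 < c /\
      p S / (S ^+ 2 * ln (S ^- 2)) @[S --> 0^'+] --> c).
Proof.
have D0 := is_continuous_spacing_density_spacing_density sigma_gt0 sigma1_gt0
  sigma2_gt0 indep density_a density_b1 density_b2.
split; first by exists (spacing_density sigma sigma1 sigma2).
move=> p [cp p0 pE]; case: D0 => cq q0 qE.
exists (gauss_density sigma 0 * gauss_density sigma1 0 * gauss_density sigma2 0).
split; first by apply: mulr_gt0; [apply: mulr_gt0|]; exact: gauss_density_gt0.
have bint := bessel_integrable_of_law sigma_gt0 sigma1_gt0 sigma2_gt0 indep
  density_a density_b1 density_b2.
have H := spacing_density_asymp sigma_gt0 sigma1_gt0 sigma2_gt0 bint.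
apply: cvg_trans H; apply: near_eq_cvg; near=> S.
have S0 : 0 < S by near: S; exact: nbhs_right_gt.
(* Any continuous density agrees with [spacing_density] at [S > 0], by two inequalities, and so
   inherits its asymptotics. *)
congr (_ / _); apply/eqP; rewrite eq_le; apply/andP; split.
  by apply: le_continuous_density => // E mE E0; rewrite -qE// -pE.
by apply: le_continuous_density => // E mE E0; rewrite -qE// -pE.
Unshelve. all: by end_near. Qed.
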